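(* Let $\mathfrak S$ be a set carrying some mathematical structure, $\mathcal F$ a filter on $\mathfrak S$ having a countable base, $(\Omega,\mu)$ a measure space, $\Phi$ a $\mu$-measurable scalar function on $\Omega$, and $(A(u))_{u\in\Omega}$ a family of automorphisms of $\mathfrak S$. Suppose that $(A(u))_{u\in\Omega}$ agrees with $\mathcal F$ and that $\int_\Omega \Phi(u)\,d\mu(u)=1$. Then the transformation $\mathcal H_{\Phi,A}$ is regular in the following sense: for every Banach space $V$ and every bounded function $f:\mathfrak S\to V$ such that the function $u\mapsto f(A(u)(x))$ is $\mu$-measurable for each $x\in\mathfrak S$, the equality $\lim_{x,\mathcal F} f(x)=l$ implies $\lim_{x,\mathcal F}(\mathcal H_{\Phi,A}f)(x)=l$.
   Context: $\mathfrak S$ is an object of a category of sets with structure; automorphisms of $\mathfrak S$ are isomorphisms $\mathfrak S\to\mathfrak S$ in this category, in particular bijections of $\mathfrak S$ (for the category of sets, automorphisms are exactly the bijections). The Hausdorff-type operator is $(\mathcal H_{\Phi,A}f)(x)=\int_\Omega \Phi(u) f(A(u)(x))\,d\mu(u)$, $x\in\mathfrak S$. Here the integral is a Lebesgue (Bochner, for $V$-valued functions) integral, and $\mu$-measurability of $V$-valued functions is understood in the sense of Bochner integration (strong measurability). The family $(A(u))_{u\in\Omega}$ agrees with the filter $\mathcal F$ if $A(u)^{-1}(B)\in\mathcal F$ for each $B\in\mathcal F$ and every $u\in\Omega$. $\lim_{x,\mathcal F} f(x)=l$ means that for every $\varepsilon>0$ there is $B_\varepsilon\in\mathcal F$ with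 $\|f(y)-l\|<\varepsilon$ for all $y\in B_\varepsilon$. *)

(* Defs.v *)
From HB Require Import structures.
From mathcomp Require Import all_boot all_order all_algebra.
From mathcomp Require Import complex.
From mathcomp Require Import all_classical all_reals all_analysis.
Import Order.TTheory GRing.Theory Num.Theory.
Import numFieldNormedType.Exports.

Set Implicit Arguments.
Unset Strict Implicit.
Unset Printing Implicit Defensive.

Local Open Scope classical_set_scope.
Local Open Scope ring_scope.

(** * Sets with structure *)

(** A category of sets with structure is a concrete category: its morphisms
    are maps between the underlying sets, and they include the identities and
    are closed under composition. *)
Record structured_sets := StructuredSets {
  object : Type;
  carrier : object -> Type;
  is_morphism : forall X Y : object, set (carrier X -> carrier Y);
  is_morphism_id : forall X, is_morphism (@id (carrier X));
  is_morphism_comp : forall X Y Z (g : carrier Y -> carrier Z)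
    (f : carrier X -> carrier Y),
    is_morphism g -> is_morphism f -> is_morphism (g \o f) }.

Definition is_automorphism (C : structured_sets) (X : object C)
    (g : carrier X -> carrier X) : Prop :=
  is_morphism g /\
  exists h : carrier X -> carrier X, [/\ is_morphism h, cancel g h & cancel h g].

(** * Filters *)

Definition has_countable_base (T : Type) (F : set_system T) : Prop :=
  exists2 D : set (set T), countable D & F = filter_from D id.

Definition agrees_with_filter (U T : Type) (A : U -> T -> T)
    (F : set_system T) : Prop :=
  forall (u : U) (B : set T), F B -> F (A u @^-1` B).

(** * Scalars *)

(** The scalar field of a Banach space is [R] or [R[i]].  Over [R[i]] the norm
    of the library takes its values in [R[i]] (in the real nonnegative half
    line), whereas measures are valued in [\bar R]; [of_real] and [re_part]
    translate between the two. *)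
Variant scalar_kind := RealScalars | ComplexScalars.

Definition scalars (R : realType) (k : scalar_kind) : numFieldType :=
  match k with RealScalars => R | ComplexScalars => R[i] end.

Definition of_real (R : realType) (k : scalar_kind) : R -> scalars R k :=
  match k with
  | RealScalars => fun x => x
  | ComplexScalars => fun x => (x%:C)%C
  end.

Definition re_part (R : realType) (k : scalar_kind) : scalars R k -> R :=
  match k with
  | RealScalars => fun z => z
  | ComplexScalars => fun z => complex.Re z
  end.

Definition rnorm (R : realType) (k : scalar_kind)
  (V : normedModType (scalars R k)) (v : V) : R := re_part `|v|.

(** * Strong measurability and the Lebesgue and Bochner integrals *)

Section integral.
Context d (Omega : measurableType d) (R : realType) (k : scalar_kind).
Variable mu : {measure set Omega -> \bar R}.
Implicit Type V : normedModType (scalars R k).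

Definition simple V (s : Omega -> V) : Prop :=
  finite_set (range s) /\ forall v, measurable (s @^-1` [set v]).

(** Limits of simple functions are taken almost everywhere, so that
    [mu]-measurability does not distinguish [mu] from its completion.  The
    simple functions need not have a support of finite measure: in particular,
    constant functions are [mu]-measurable for every [mu]. *)
Definition mu_measurable V (f : Omega -> V) : Prop :=
  exists2 s : nat -> Omega -> V, (forall n, simple (s n)) &
    {ae mu, forall u, s n u @[n --> \oo] --> f u}.

(** For a [mu]-measurable [f] the function [rnorm \o f] coincides almost
    everywhere with a measurable one.  This is all that is needed below for
    [\int[mu]] to be the usual integral: for a nonnegative integrand it is the
    supremum of the integrals of the nonnegative simple functions below it,
    which is insensitive to [mu]-null sets. *)
Definition lebesgue_integrable (f : Omega -> scalars R k) : Prop :=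
  mu_measurable f /\ (\int[mu]_u (rnorm (f u))%:E < +oo)%E.

Definition lebesgue_integral : (Omega -> scalars R k) -> scalars R k :=
  match k return (Omega -> scalars R k) -> scalars R k with
  | RealScalars => fun f => \int[mu]_u f u
  | ComplexScalars => fun f =>
      ((\int[mu]_u complex.Re (f u)) +i* (\int[mu]_u complex.Im (f u)))%C
  end.

Definition integrable_simple V (s : Omega -> V) : Prop :=
  simple s /\ forall v, v != 0 -> (mu (s @^-1` [set v]) < +oo)%E.

(** The value [0] may be taken on a set of infinite measure; its contribution
    to the sum is [0]. *)
Definition simple_integral V (s : Omega -> V) : V :=
  \sum_(v \in range s) of_real k (fine (mu (s @^-1` [set v]))) *: v.

Definition bochner_approximation V (f : Omega -> V) (s : nat -> Omega -> V) :
    Prop :=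
  [/\ forall n, integrable_simple (s n),
      {ae mu, forall u, s n u @[n --> \oo] --> f u} &
      (\int[mu]_u (rnorm (f u - s n u))%:E)%E @[n --> \oo] --> (0 : \bar R)%E].

Definition bochner_integrable V (f : Omega -> V) : Prop :=
  exists s, bochner_approximation f s.

(** The value is [0] by convention if there is no such limit, e.g. if [f] is
    not Bochner integrable. *)
Definition bochner_integral V (f : Omega -> V) : V :=
  xget 0 [set v | exists2 s, bochner_approximation f s &
                   simple_integral (s n) @[n --> \oo] --> v].

End integral.

(** * The Hausdorff-type operator *)

Definition hausdorff_operator d (Omega : measurableType d) (R : realType)
    (k : scalar_kind) (mu : {measure set Omega -> \bar R}) (T : Type)
    (Phi : Omega -> scalars R k) (A : Omega -> T -> T)
    (V : normedModType (scalars R k)) (f : T -> V) (x : T) : V :=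
  bochner_integral mu (fun u => Phi u *: f (A u x)).

(* Main.v *)
Require Import Defs.
From HB Require Import structures.
From mathcomp Require Import all_boot all_order all_algebra.
From mathcomp Require Import complex.
From mathcomp Require Import finmap.
From mathcomp Require Import all_classical all_reals all_analysis.
From mathcomp Require Import measurable_realfun.
Import Order.TTheory GRing.Theory Num.Theory.
Import numFieldNormedType.Exports.
Local Open Scope classical_set_scope.
Local Open Scope ring_scope.
Set Implicit Arguments.
Unset Strict Implicit.
Unset Printing Implicit Defensive.

(** Fix [l] and let [f] tend to [l] along the filter.  Since the integral of
    [Phi] is [1], the integral of [Phi u *: l] is [l], so that
    [rnorm (H f x - l)] is at most the integral over [u] of
    [rnorm (Phi u) * rnorm (f (A u x) - l)].

    The filter has a countable base, hence it suffices to let [x] run through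
    the terms of a sequence [x n] tending to the filter ([countable_base_cvg]).
    For each fixed [u], the sequence [A u (x n)] also tends to the filter, which
    is what the agreement of the family with the filter means; so the integrand
    tends to [0] for every [u].  It is dominated by a multiple of
    [rnorm (Phi u)] because [f] is bounded, and dominated convergence concludes.

    The rest is a development of the Bochner integral: functions that are
    strongly measurable and whose norm is integrable are Bochner integrable
    ([bochner_integrable_of_integrable_norm]), integrals are defined
    in a Banach space ([bochner_integral_spec]), the norm of a difference of
    integrals is at most the integral of the norm ([bochner_limit_dist]), and
    for scalar functions the Bochner integral is the Lebesgue integral
    ([cvg_lebesgue_integral]).

    Strongly measurable functions are limits of simple functions almost
    everywhere only, so their norms need not be measurable for the given
    sigma-algebra.  The integral of a nonnegative function is however blind to
    null sets without any measurability ([ge0_ae_le_integral]); it is therefore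
    enough to work with functions that are equal almost everywhere to
    measurable ones ([ae_measurable]). *)

(** * Real norms over real or complex scalars *)

Section scalars_theory.
Context (R : realType) (k : scalar_kind).
Implicit Types (x y : R) (z : scalars R k).

Lemma of_real0 : of_real k (0 : R) = 0. Proof. by case: k. Qed.
Lemma of_realD x y : of_real k (x + y) = of_real k x + of_real k y.
Proof. by case: k => //=; rewrite rmorphD. Qed.
Lemma of_realM x y : of_real k (x * y) = of_real k x * of_real k y.
Proof. by case: k => //=; rewrite rmorphM. Qed.
Lemma re_part_of_real x : re_part (of_real k x) = x.
Proof. by case: k. Qed.
Lemma ler_of_real x y : (of_real k x <= of_real k y) = (x <= y).
Proof. by case: k => //=; rewrite lecR. Qed.
Lemma ltr_of_real x y : (of_real k x < of_real k y) = (x < y).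
Proof. by case: k => //=; rewrite ltcR. Qed.
Lemma of_real_re_part z : 0 <= z -> of_real k (re_part z) = z.
Proof.
case: k z => //= -[a b]; rewrite lecE /= => /andP[/eqP -> _] //.
Qed.
Lemma normr_of_real x : `|of_real k x| = of_real k `|x|.
Proof. by case: k => //=; rewrite normc_def /= expr0n addr0 sqrtr_sqr. Qed.
End scalars_theory.

Section rnorm_theory.
Context (R : realType) (k : scalar_kind) (V : normedModType (scalars R k)).
Implicit Types v w : V.

Lemma of_real_rnorm v : of_real k (rnorm v) = `|v|.
Proof. exact: of_real_re_part. Qed.
Lemma rnorm_ge0 v : 0 <= rnorm v.
Proof. by rewrite -(ler_of_real k) of_real_rnorm of_real0. Qed.
Lemma rnorm0 : rnorm (0 : V) = 0.
Proof. by rewrite /rnorm normr0 -(of_real0 R k) re_part_of_real. Qed.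
Lemma rnorm0_eq0 v : rnorm v = 0 -> v = 0.
Proof. by move=> v0; apply/normr0_eq0; rewrite -of_real_rnorm v0 of_real0. Qed.
Lemma rnormN v : rnorm (- v) = rnorm v.
Proof. by rewrite /rnorm normrN. Qed.
Lemma rnormB v w : rnorm (v - w) = rnorm (w - v).
Proof. by rewrite /rnorm distrC. Qed.
Lemma ler_rnormD v w : rnorm (v + w) <= rnorm v + rnorm w.
Proof. by rewrite -(ler_of_real k) of_realD !of_real_rnorm ler_normD. Qed.
Lemma rnormZ (a : scalars R k) v : rnorm (a *: v) = rnorm a * rnorm v.
Proof.
rewrite -[LHS](re_part_of_real k) of_real_rnorm normrZ.
rewrite -(of_real_rnorm v) -[X in X * _]of_real_re_part//.
by rewrite -of_realM re_part_of_real.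
Qed.
Lemma rnormZ_of_real (x : R) v : rnorm (of_real k x *: v) = `|x| * rnorm v.
Proof.
by rewrite rnormZ {1}/rnorm normr_of_real re_part_of_real.
Qed.

(** The filters at [0] of [R[i]] and of [R] correspond because a positive
    complex number is a positive real one: convergence in [V] can be tested
    with real radii for both kinds of scalars. *)
Lemma cvg_rnormP T (F : set_system T) {FF : Filter F} (g : T -> V) (l : V) :
  g @ F --> l <-> rnorm (g x - l) @[x --> F] --> (0 : R).
Proof.
split=> [/cvgrPdist_lt gl|/cvgrPdist_lt gl]; apply/cvgrPdist_lt => e e0.
  have e0' : 0 < of_real k e by rewrite -(of_real0 R) ltr_of_real.
  apply: filterS (gl _ e0') => x; rewrite -of_real_rnorm ltr_of_real.
  by rewrite sub0r normrN ger0_norm ?rnorm_ge0// rnormB.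
have eE := of_real_re_part (ltW e0).
have e0' : 0 < re_part e by rewrite -(ltr_of_real k) eE of_real0.
apply: filterS (gl _ e0') => x.
rewrite sub0r normrN ger0_norm ?rnorm_ge0// => xe.
by rewrite -of_real_rnorm -eE ltr_of_real rnormB.
Qed.
End rnorm_theory.

(** * Integration up to null sets *)

Section ae_integral.
Context d (T : measurableType d) (R : realType).
Variable mu : {measure set T -> \bar R}.
Local Open Scope ereal_scope.
Import HBNNSimple.

(** For arbitrary nonnegative functions the integral is the supremum of the
    integrals of the nonnegative simple functions below; setting such a simple
    function to [0] on a null set does not change its integral, so null sets
    are invisible even without measurability. *)
Lemma ge0_ae_le_integral (f g : T -> \bar R) :
  (forall x, 0 <= f x) -> (forall x, 0 <= g x) ->
  {ae mu, forall x, f x <= g x} -> \int[mu]_x f x <= \int[mu]_x g x.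
Proof.
move=> f0 g0 [N [mN N0 fgN]].
rewrite !ge0_integralTE//; apply: ge_ereal_sup => _ [h hf <-].
have mNC : measurable (~` N) by exact: measurableC.
apply: ereal_sup_ubound; exists (proj_nnsfun h mNC).
  move=> x /=; rewrite mindicE; case: (boolP (x \in ~` N)) => [xN|_].
    rewrite mulr1 (le_trans (hf x))//; apply: contrapT => fgx.
    by move: xN; rewrite inE; apply; apply: fgN.
  by rewrite mulr0.
rewrite -!integralT_nnsfun; apply: ge0_ae_eq_integral => //.
- by apply/measurable_EFinP; exact: measurable_funPT.
- by apply/measurable_EFinP; exact: measurable_funPT.
- by move=> x _; rewrite lee_fin.
- by move=> x _; rewrite lee_fin.
- exists N; split => // x /= hx; apply: contrapT => xN; apply: hx => _.
  by rewrite /= mindicE mem_set// mulr1.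
Qed.

Lemma ge0_ae_eq_integral_nonmeasurable (f g : T -> \bar R) :
  (forall x, 0 <= f x) -> (forall x, 0 <= g x) ->
  {ae mu, forall x, f x = g x} -> \int[mu]_x f x = \int[mu]_x g x.
Proof.
move=> f0 g0 fg; apply/eqP; rewrite eq_le; apply/andP; split.
  by apply: ge0_ae_le_integral => //; apply: filterS fg => x ->.
by apply: ge0_ae_le_integral => //; apply: filterS fg => x ->.
Qed.

Lemma ae_eq_integral_nonmeasurable (f g : T -> \bar R) :
  {ae mu, forall x, f x = g x} -> \int[mu]_x f x = \int[mu]_x g x.
Proof.
move=> fg; rewrite integralE [RHS]integralE; congr (_ - _);
  apply: ge0_ae_eq_integral_nonmeasurable => //;
  by apply: filterS fg => x; rewrite ?funeposE ?funenegE => ->.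
Qed.

(** Norms of strongly measurable functions are only measurable up to a null
    set, since strong measurability is an almost everywhere notion.  Such
    functions obey the usual rules of integration: replace them by a measurable
    version, which has the same integral by
    [ge0_ae_eq_integral_nonmeasurable]. *)
Definition ae_measurable (h : T -> R) : Prop :=
  exists2 h' : T -> R, measurable_fun setT h' & {ae mu, forall x, h x = h' x}.

Lemma ge0_ae_measurable (h : T -> R) : (forall x, 0 <= h x)%R ->
  ae_measurable h ->
  exists2 h' : T -> R, measurable_fun setT h' /\ (forall x, 0 <= h' x)%R &
    {ae mu, forall x, h x = h' x}.
Proof.
move=> h0 [h' mh' hh']; exists (fun x => `|h' x|)%R.
  by split=> //; exact: measurableT_comp.
by apply: filterS hh' => x <-; rewrite ger0_norm.
Qed.

(** Additivity is where almost everywhere measurability matters: the supremum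
    over simple functions is merely superadditive in general. *)
Lemma ae_integralD (f g : T -> R) :
  (forall x, 0 <= f x)%R -> (forall x, 0 <= g x)%R ->
  ae_measurable f -> ae_measurable g ->
  \int[mu]_x (f x + g x)%:E = \int[mu]_x (f x)%:E + \int[mu]_x (g x)%:E.
Proof.
move=> f0 g0 /(ge0_ae_measurable f0)[f' [mf' f'0] ff'].
move=> /(ge0_ae_measurable g0)[g' [mg' g'0] gg'].
transitivity (\int[mu]_x ((f' x)%:E + (g' x)%:E)).
  apply: ge0_ae_eq_integral_nonmeasurable => [x|x|].
  - by rewrite lee_fin addr_ge0.
  - by rewrite -EFinD lee_fin addr_ge0.
  - by apply: filterS2 ff' gg' => x -> ->.
rewrite ge0_integralD//; [|by move=> x _; rewrite lee_fin|exact/measurable_EFinP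
  |by move=> x _; rewrite lee_fin|exact/measurable_EFinP].
congr (_ + _); apply: ge0_ae_eq_integral_nonmeasurable => [x|x|];
  rewrite ?lee_fin//.
  by apply: filterS ff' => x ->.
by apply: filterS gg' => x ->.
Qed.

Lemma ae_measurableZl (c : R) (f : T -> R) :
  ae_measurable f -> ae_measurable (fun x => c * f x)%R.
Proof.
move=> [f' mf' ff']; exists (fun x => c * f' x)%R; first exact: measurable_funM.
by apply: filterS ff' => x ->.
Qed.

Lemma ae_integralZl (c : R) (f : T -> R) : (0 <= c)%R ->
  (forall x, 0 <= f x)%R -> ae_measurable f ->
  \int[mu]_x (c * f x)%:E = c%:E * \int[mu]_x (f x)%:E.
Proof.
move=> c0 f0 /(ge0_ae_measurable f0)[f' [mf' f'0] ff'].
transitivity (\int[mu]_x (c%:E * (f' x)%:E)).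
  apply: ge0_ae_eq_integral_nonmeasurable => [x|x|].
  - by rewrite lee_fin mulr_ge0.
  - by rewrite -EFinM lee_fin mulr_ge0.
  - by apply: filterS ff' => x ->.
rewrite ge0_integralZl//;
  [|exact/measurable_EFinP|by move=> x _; rewrite lee_fin].
congr (_ * _); apply: ge0_ae_eq_integral_nonmeasurable => [x|x|];
  rewrite ?lee_fin//.
by apply: filterS ff' => x ->.
Qed.

Lemma ae_dominated_cvg0 (h : nat -> T -> R) (G : T -> R) :
  (forall n x, 0 <= h n x)%R -> (forall x, 0 <= G x)%R ->
  (forall n, ae_measurable (h n)) -> ae_measurable G ->
  (forall n, {ae mu, forall x, h n x <= G x})%R ->
  {ae mu, forall x, h n x @[n --> \oo] --> 0%R} ->
  \int[mu]_x (G x)%:E < +oo ->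
  \int[mu]_x (h n x)%:E @[n --> \oo] --> 0.
Proof.
move=> h0 G0 mh mG hG hcvg Goo.
have /choice[h' h'P] : forall n, exists h' : T -> R,
    (measurable_fun setT h' /\ forall x, 0 <= h' x)%R /\
    {ae mu, forall x, h n x = h' x}.
  by move=> n; have [h' ? ?] := ge0_ae_measurable (h0 n) (mh n); exists h'.
have [G' [mG' G'0] GG'] := ge0_ae_measurable G0 mG.
have hh' : {ae mu, forall x n, h n x = h' n x}.
  by apply/ae_foralln => n; exact: (h'P n).2.
have hGn : {ae mu, forall x n, h n x <= G x}%R by exact/ae_foralln.
have intE n : \int[mu]_x (h n x)%:E = \int[mu]_x (h' n x)%:E.
  apply: ge0_ae_eq_integral_nonmeasurable => [x|x|]; rewrite ?lee_fin//.
    exact: (h'P n).1.2.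
  by apply: filterS (h'P n).2 => x ->.
under eq_fun do rewrite intE.
have mh' n : measurable_fun setT (fun x => (h' n x)%:E).
  by apply/measurable_EFinP; exact: (h'P n).1.1.
have h'cvg : {ae mu, forall x, setT x -> (h' n x)%:E @[n --> \oo] --> 0}.
  apply: filterS2 hcvg hh' => x hx hhx _; apply: cvg_EFin.
    by near=> n.
  by apply: cvg_trans hx; apply: near_eq_cvg; near=> n; rewrite /= hhx.
have iG' : mu.-integrable setT (fun x => (G' x)%:E).
  apply/integrableP; split; first exact/measurable_EFinP.
  under eq_integral do rewrite gee0_abs ?lee_fin//.
  apply: le_lt_trans Goo; apply: ge0_ae_le_integral => [x|x|];
    rewrite ?lee_fin//.
  by apply: filterS GG' => x ->.
have h'G' : {ae mu, forall x n, setT x -> `|(h' n x)%:E| <= (G' x)%:E}.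
  apply: filterS3 hGn hh' GG' => x hGx hhx GGx n _.
  by rewrite -hhx -GGx gee0_abs ?lee_fin.
have [_ _] := dominated_convergence measurableT mh' (measurable_cst _) h'cvg
  iG' h'G'.
by rewrite integral0.
Unshelve. all: by end_near. Qed.
End ae_integral.

(** * Simple maps and their integrals *)

Section simple_map.
Context d (T : measurableType d).

(** The maps [s] with [simple s], but with values in an arbitrary type: this
    makes it possible to treat two simple functions at once, as one simple map
    into a product, and to use [bool] for the membership in a measurable set. *)
Definition simple_map (X : Type) (p : T -> X) : Prop :=
  finite_set (range p) /\ forall x, measurable (p @^-1` [set x]).

Lemma simple_map_measurable (X : Type) (p : T -> X) (B : set X) :
  simple_map p -> measurable (p @^-1` B).
Proof.
move=> [finp mp].
rewrite (_ : _ @^-1` _ = \bigcup_(x in range p `&` B) p @^-1` [set x]).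
  by apply: fin_bigcup_measurable => //; exact: finite_setIl.
apply/seteqP; split => [u Bu|u [x [_ Bx] /= ->]//].
by exists (p u) => //; split => //; exists u.
Qed.

Lemma simple_map_comp (X Y : Type) (p : T -> X) (phi : X -> Y) :
  simple_map p -> simple_map (phi \o p).
Proof.
move=> sp; split; last first.
  by move=> y; rewrite comp_preimage; exact: simple_map_measurable.
rewrite (_ : range _ = phi @` range p); first exact/finite_image/sp.1.
by rewrite image_comp.
Qed.

Lemma simple_map_pair (X Y : Type) (p : T -> X) (q : T -> Y) :
  simple_map p -> simple_map q -> simple_map (fun u => (p u, q u)).
Proof.
move=> [finp mp] [finq mq]; split.
  apply: sub_finite_set (finite_setX finp finq) => _ [u _ <-].
  by split; exists u.
move=> [x y]; rewrite (_ : _ @^-1` _ = p @^-1` [set x] `&` q @^-1` [set y]).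
  exact: measurableI.
by apply/seteqP; split => u /= [-> ->].
Qed.

Lemma simple_map_mem (A : set T) : measurable A ->
  simple_map (fun u => u \in A).
Proof.
move=> mA; split; first exact: finite_finset.
case.
  rewrite (_ : _ @^-1` _ = A)//; apply/seteqP; split => u /=.
    exact: set_mem.
  exact: mem_set.
rewrite (_ : _ @^-1` _ = ~` A); first exact: measurableC.
apply/seteqP; split => u /=; last exact: memNset.
by move=> uA Au; move: uA; rewrite mem_set.
Qed.

Lemma simple_map_measurable_fun (R : realType) (X : Type) (p : T -> X)
  (phi : X -> R) : simple_map p -> measurable_fun setT (phi \o p).
Proof.
move=> sp _ B mB; rewrite setTI; apply: simple_map_measurable.
exact: simple_map_comp.
Qed.

Context (R : realType) (mu : {measure set T -> \bar R}).

Lemma measure_preimage_comp (X : choiceType) (Y : eqType) (p : T -> X)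
  (phi : X -> Y) (y : Y) : simple_map p ->
  mu ((phi \o p) @^-1` [set y]) =
  (\sum_(x <- fset_set (range p) | phi x == y) mu (p @^-1` [set x]))%E.
Proof.
move=> [finp mp].
pose F x := if phi x == y then p @^-1` [set x] else set0.
rewrite (_ : _ @^-1` _ = \bigcup_(x in range p) F x); last first.
  apply/seteqP; split => [u /= uy|u [x _]]; rewrite /F /=.
    by exists (p u) => //; rewrite uy eqxx.
  by case: eqP => //= xy ->.
rewrite measure_fin_bigcup//.
- rewrite fsbig_finite// [RHS]big_mkcond/=; apply: eq_bigr => x _.
  by rewrite /F; case: eqP => // _; rewrite measure0.
- move=> a b _ _ [u []]; rewrite /F.
  by case: eqP => // _ /= <-; case: eqP => // _ /= <-.
- by move=> x _; rewrite /F; case: eqP.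
Qed.

Lemma measure_fiber (X : Type) (p : T -> X) x :
  (mu (p @^-1` [set x]) < +oo)%E ->
  mu (p @^-1` [set x]) = (fine (mu (p @^-1` [set x])))%:E.
Proof. by move=> mux; rewrite fineK// ge0_fin_numE. Qed.

Section integral_comp.
Context (X : choiceType) (p : T -> X).
Hypothesis sp : simple_map p.

Lemma integral_simple_comp (psi : X -> R) :
  (forall x, psi x != 0 -> (mu (p @^-1` [set x]) < +oo)%E) ->
  mu.-integrable setT (fun u => (psi (p u))%:E) /\
  (\int[mu]_u (psi (p u))%:E =
  (\sum_(x <- fset_set (range p)) fine (mu (p @^-1` [set x])) * psi x)%:E)%E.
Proof.
move=> psioo.
have [finp mp] := sp.
pose F x u := ((psi x)%:E * (\1_(p @^-1` [set x]) u)%:E)%E.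
have psiE u : (psi (p u))%:E = (\sum_(x <- fset_set (range p)) F x u)%E.
  rewrite (bigD1_seq (p u))/=; [|by rewrite in_fset_set ?inE//|exact: fset_uniq].
  rewrite big1 ?addr0 => [|x /eqP xpu].
    by rewrite /F indicE mem_set// mule1.
  by rewrite /F indicE memNset ?mule0//= => /esym.
have iF x : mu.-integrable setT (F x) /\
    (\int[mu]_u F x u = (fine (mu (p @^-1` [set x])) * psi x)%:E)%E.
  have [p0|p0] := eqVneq (psi x) 0.
    rewrite (_ : F x = cst 0%E); last first.
      by apply/funext => u; rewrite /F p0 mul0e.
    by rewrite p0 mulr0 integral0; split => //; exact: integrable0.
  have i1 : mu.-integrable setT (fun u => (\1_(p @^-1` [set x]) u : R)%:E).
    apply/integrableP; split.
      by apply/measurable_EFinP; exact: measurable_indic.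
    under eq_integral do rewrite gee0_abs ?lee_fin//.
    by rewrite integral_indic// setIT; exact: psioo.
  split; first exact: integrableZl.
  rewrite /F integralZl// integral_indic// setIT measure_fiber; last exact: psioo.
  by rewrite -EFinM mulrC.
split.
  under eq_fun do rewrite psiE.
  by apply: integrable_sum => // x _; exact: (iF x).1.
under eq_integral do rewrite psiE.
rewrite integral_sum//; last by move=> x; exact: (iF x).1.
by rewrite -sumEFin; apply: eq_bigr => x _; exact: (iF x).2.
Qed.
End integral_comp.

End simple_map.


Section simple_integral.
Context d (T : measurableType d) (R : realType) (k : scalar_kind).
Context (mu : {measure set T -> \bar R}) (V : normedModType (scalars R k)).

(** The integral of a simple function may be computed along any simple map [p]
    through which it factors, by grouping the fibres of [p] on which [phi] is
    constant.  With [p] a pair of simple functions this gives additivity. *)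
Lemma simple_integral_comp (X : choiceType) (p : T -> X) (phi : X -> V) :
  simple_map p ->
  (forall x, phi x != 0 -> (mu (p @^-1` [set x]) < +oo)%E) ->
  integrable_simple mu (phi \o p) /\
  simple_integral mu (phi \o p) =
    \sum_(x <- fset_set (range p))
      of_real k (fine (mu (p @^-1` [set x]))) *: phi x.
Proof.
move=> sp phioo.
have sphi := simple_map_comp phi sp.
have muE (v : V) : v != 0 -> (mu ((phi \o p) @^-1` [set v]) =
  (\sum_(x <- fset_set (range p) | phi x == v)
     fine (mu (p @^-1` [set x])))%:E)%E.
  move=> v0; rewrite measure_preimage_comp// -sumEFin.
  by apply: eq_bigr => x /eqP xv; apply/measure_fiber/phioo; rewrite xv.
split; first by split => // v /muE ->; exact: ltry.
rewrite /simple_integral fsbig_finite; last exact: sphi.1.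
transitivity (\sum_(v <- fset_set (range (phi \o p)))
  \sum_(x <- fset_set (range p) | phi x == v)
     of_real k (fine (mu (p @^-1` [set x]))) *: phi x).
  apply: eq_bigr => v _; have [->|/muE ->] := eqVneq v 0.
    by rewrite scaler0 big1// => x /eqP ->; rewrite scaler0.
  rewrite /= (big_morph (of_real k) (@of_realD R k) (of_real0 R k)) scaler_suml.
  by apply: eq_bigr => x /eqP ->.
rewrite (exchange_big_dep xpredT)//=; apply: eq_big_seq => x.
rewrite in_fset_set ?inE; last exact: sp.1.
move=> [u _ xu]; rewrite big_mkcond (bigD1_seq (phi x))/=; last exact: fset_uniq.
  by rewrite eqxx big1 ?addr0// => v; rewrite eq_sym => /negPf ->.
by rewrite in_fset_set ?inE; [exists u => //=; rewrite xu|exact: sphi.1].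
Qed.

Lemma le_rnorm_simple_integral (s : T -> V) : integrable_simple mu s ->
  ((rnorm (simple_integral mu s))%:E <= \int[mu]_u (rnorm (s u))%:E)%E.
Proof.
move=> [ss soo].
have rnormoo v : rnorm v != 0 -> (mu (s @^-1` [set v]) < +oo)%E.
  by move=> v0; apply: soo; apply: contraNneq v0 => ->; rewrite rnorm0.
have [_ ->] := integral_simple_comp ss rnormoo.
rewrite lee_fin (_ : simple_integral _ _ = simple_integral mu (id \o s))//.
have [_ ->] := simple_integral_comp (phi := id) ss soo.
elim/big_ind2 : _ => [|? ? ? ? h1 h2|v _]; first by rewrite rnorm0.
  by rewrite (le_trans (ler_rnormD _ _))// lerD.
by rewrite rnormZ_of_real ger0_norm// fine_ge0.
Qed.

Lemma integrable_simple_pair (s t : T -> V) : integrable_simple mu s ->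
  integrable_simple mu t -> forall x : V * V, x != 0 ->
  (mu ((fun u => (s u, t u)) @^-1` [set x]) < +oo)%E.
Proof.
move=> [ss soo] [st too] [a b] ab0.
have [a0|/soo] := eqVneq a 0; last first.
  apply: le_lt_trans; apply: le_measure; rewrite ?inE//.
  - exact: (simple_map_pair ss st).2.
  - exact: ss.2.
  - by move=> u [].
have /too : b != 0 by apply: contraNneq ab0 => ->; rewrite a0.
apply: le_lt_trans; apply: le_measure; rewrite ?inE//.
- exact: (simple_map_pair ss st).2.
- exact: st.2.
- by move=> u [].
Qed.

Lemma simple_integralB (s t : T -> V) : integrable_simple mu s ->
  integrable_simple mu t ->
  integrable_simple mu (fun u => s u - t u) /\
  simple_integral mu (fun u => s u - t u) =
  simple_integral mu s - simple_integral mu t.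
Proof.
move=> is_ it; have st := simple_map_pair is_.1 it.1.
have stoo := integrable_simple_pair is_ it.
have comp (phi : V * V -> V) : phi 0 = 0 -> forall x, phi x != 0 ->
    (mu ((fun u => (s u, t u)) @^-1` [set x]) < +oo)%E.
  by move=> phi0 x x0; apply: stoo; apply: contraNneq x0 => ->; rewrite phi0.
have [iB BE] := simple_integral_comp st (comp (fun x => x.1 - x.2) (subrr 0)).
have [_ sE] := simple_integral_comp st (comp fst erefl).
have [_ tE] := simple_integral_comp st (comp snd erefl).
split => //.
rewrite [LHS]BE [simple_integral mu s]sE [simple_integral mu t]tE -sumrB.
by apply: eq_bigr => x _; rewrite scalerBr.
Qed.

End simple_integral.

(** * Strong measurability *)

Section strong_measurability.
Context d (T : measurableType d) (R : realType) (k : scalar_kind).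
Context (mu : {measure set T -> \bar R}).

(** Setting everything to [0] on a measurable null set that contains the
    exceptional points turns convergence almost everywhere into convergence
    everywhere. *)
Lemma mu_measurable_ptws (V : normedModType (scalars R k)) (g : T -> V) :
  mu_measurable mu g ->
  exists g' s, [/\ (forall n, simple (s n)),
    (forall u, s n u @[n --> \oo] --> g' u) & {ae mu, forall u, g u = g' u}].
Proof.
move=> [s ss [N [mN N0 cvgN]]].
pose cut (x : bool * V) : V := if x.1 then 0 else x.2.
exists (fun u => cut (u \in N, g u)), (fun n u => cut (u \in N, s n u)); split.
- by move=> n; exact: (simple_map_comp cut
    (simple_map_pair (simple_map_mem mN) (ss n))).
- move=> u; rewrite /cut /=; case: ifPn => [_|uN]; first exact: cvg_cst.
  by apply: contrapT => nu; move/negP: uN; apply; rewrite inE; exact: cvgN.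
- exists N; split => // u /= gu; apply: contrapT => uN; apply: gu.
  by rewrite /cut /= memNset.
Qed.

Lemma ler_dist_rnorm (V : normedModType (scalars R k)) (v w : V) :
  `|rnorm v - rnorm w| <= rnorm (v - w).
Proof.
have := ler_rnormD (v - w) w; have := ler_rnormD (w - v) v.
rewrite !subrK (rnormB w) => wv vw.
by rewrite ler_norml lerBlDr vw andbT lerBrDr addrC lerBlDl.
Qed.

Lemma measurable_nonexpansive_lim (V : normedModType (scalars R k))
  (s : nat -> T -> V) (g : T -> V) (phi : V -> R) :
  (forall v w, `|phi v - phi w| <= rnorm (v - w)) ->
  (forall n, simple (s n)) -> (forall u, s n u @[n --> \oo] --> g u) ->
  measurable_fun setT (phi \o g).
Proof.
move=> phiL ss sg.
apply: (@measurable_fun_cvg _ _ _ _ (fun n => phi \o s n)) => [n|u _].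
  exact: simple_map_measurable_fun (ss n).
apply/cvgrPdist_le => e e0.
have /cvg_rnormP/cvgrPdist_le/(_ e e0) := sg u.
apply: filterS => n; rewrite sub0r normrN ger0_norm ?rnorm_ge0// => le_e.
by rewrite /= distrC (le_trans (phiL _ _)).
Qed.

Lemma ae_measurable_nonexpansive (V : normedModType (scalars R k)) (g : T -> V)
  (phi : V -> R) : (forall v w, `|phi v - phi w| <= rnorm (v - w)) ->
  mu_measurable mu g -> ae_measurable mu (phi \o g).
Proof.
move=> phiL /mu_measurable_ptws[g' [s [ss sg' gg']]].
exists (phi \o g'); last by apply: filterS gg' => u /= ->.
exact: measurable_nonexpansive_lim ss sg'.
Qed.

Lemma ae_measurable_rnorm (V : normedModType (scalars R k)) (g : T -> V) :
  mu_measurable mu g -> ae_measurable mu (fun u => rnorm (g u)).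
Proof. exact/ae_measurable_nonexpansive/ler_dist_rnorm. Qed.

Lemma mu_measurable_map2 (U V W : normedModType (scalars R k))
  (op : U * V -> W) (f : T -> U) (g : T -> V) :
  continuous op -> mu_measurable mu f -> mu_measurable mu g ->
  mu_measurable mu (fun u => op (f u, g u)).
Proof.
move=> cop [s ss sf] [t st tg].
exists (fun n u => op (s n u, t n u)).
  by move=> n; exact: (simple_map_comp op (simple_map_pair (ss n) (st n))).
apply: filterS2 sf tg => u su tu.
have stu : (s n u, t n u) @[n --> \oo] --> (f u, g u) by exact: cvg_pair.
exact: (cvg_comp _ _ stu (cop _)).
Qed.

Lemma simple_mu_measurable (V : normedModType (scalars R k)) (s : T -> V) :
  simple s -> mu_measurable mu s.
Proof.
by move=> ss; exists (fun=> s) => //; apply: aeW => u; exact: cvg_cst.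
Qed.

Lemma mu_measurableB (V : normedModType (scalars R k)) (f g : T -> V) :
  mu_measurable mu f -> mu_measurable mu g ->
  mu_measurable mu (fun u => f u - g u).
Proof.
move=> mf mg; apply: (mu_measurable_map2 (op := fun x => x.1 - x.2) _ mf mg).
exact: sub_continuous.
Qed.

Lemma mu_measurableZ (V : normedModType (scalars R k)) (f : T -> scalars R k)
  (g : T -> V) : mu_measurable mu f -> mu_measurable mu g ->
  mu_measurable mu (fun u => f u *: g u).
Proof.
move=> mf mg.
apply: (mu_measurable_map2 (op := fun x : scalars R k * V => x.1 *: x.2)
  _ mf mg).
exact: scale_continuous.
Qed.

Lemma bochner_approximation_mu_measurable (V : normedModType (scalars R k))
  (g : T -> V) s : bochner_approximation mu g s -> mu_measurable mu g.
Proof. by move=> [is_ sg _]; exists s => // n; exact: (is_ n).1. Qed.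

End strong_measurability.

(** * The Bochner integral *)

Section bochner.
Context d (T : measurableType d) (R : realType) (k : scalar_kind).
Context (mu : {measure set T -> \bar R}).

Section normed.
Context (V : normedModType (scalars R k)).
Implicit Types f g h : T -> V.

Local Notation dist f g := (\int[mu]_u (rnorm (f u - g u))%:E)%E.

Lemma integral_dist_triangle f g h :
  mu_measurable mu f -> mu_measurable mu g -> mu_measurable mu h ->
  (dist f h <= dist f g + dist g h)%E.
Proof.
move=> mf mg mh; rewrite -ae_integralD => [|u|u||];
  rewrite ?rnorm_ge0//; try exact/ae_measurable_rnorm/mu_measurableB.
apply: ge0_ae_le_integral => [u|u|]; rewrite ?lee_fin ?addr_ge0 ?rnorm_ge0//.
apply: aeW => u; rewrite lee_fin.
by rewrite -[f u - h u](subrKA (g u)) ler_rnormD.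
Qed.

Lemma le_dist_simple_integral (s t : T -> V) : integrable_simple mu s ->
  integrable_simple mu t ->
  ((rnorm (simple_integral mu s - simple_integral mu t))%:E <= dist s t)%E.
Proof.
move=> is_ it; have [iB <-] := simple_integralB is_ it.
exact: le_rnorm_simple_integral.
Qed.

Lemma integral_distC f g : dist f g = dist g f.
Proof. by apply: eq_integral => u _; rewrite rnormB. Qed.

(** Bounds the norm of a difference of integrals by the integral of the norm.
    Taken with [f = g], it also shows that the Bochner integral does not depend
    on the approximation. *)
Lemma bochner_limit_dist f g s t v w :
  bochner_approximation mu f s -> bochner_approximation mu g t ->
  simple_integral mu (s n) @[n --> \oo] --> v ->
  simple_integral mu (t n) @[n --> \oo] --> w ->
  ((rnorm (v - w))%:E <= dist f g)%E.
Proof.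
move=> as_ at_ sv tw; have [is_ _ sf] := as_; have [it _ tg] := at_.
have mf := bochner_approximation_mu_measurable as_.
have mg := bochner_approximation_mu_measurable at_.
have ms n := simple_mu_measurable mu (is_ n).1.
have mt n := simple_mu_measurable mu (it n).1.
have lim1 : (rnorm (simple_integral mu (s n) - simple_integral mu (t n)))%:E
    @[n --> \oo] --> (rnorm (v - w))%:E.
  apply: cvg_EFin; first by near=> n.
  apply/cvgrPdist_le => e e0.
  have vw : simple_integral mu (s n) - simple_integral mu (t n) @[n --> \oo] -->
    v - w by exact: cvgB.
  have /cvg_rnormP/cvgrPdist_le/(_ e e0) := vw.
  apply: filterS => n; rewrite sub0r normrN ger0_norm ?rnorm_ge0// rnormB.
  by apply: le_trans; exact: ler_dist_rnorm.
have lim2 : (dist f (s n) + (dist f g + dist g (t n)))%E @[n --> \oo] -->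
    (0 + (dist f g + 0))%E.
  apply: cvgeD => //; apply: cvgeD => //; last exact: cvg_cst.
  exact: fin_num_adde_defl.
rewrite (_ : dist f g = 0 + (dist f g + 0))%E; last by rewrite adde0 add0e.
rewrite -(cvg_lim _ lim1)// -(cvg_lim _ lim2)//.
apply: lee_lim; [by apply/cvg_ex; eexists; exact: lim1
  |by apply/cvg_ex; eexists; exact: lim2|].
near=> n.
apply: (le_trans (le_dist_simple_integral (is_ n) (it n))).
apply: (le_trans (integral_dist_triangle (ms n) mf (mt n))).
rewrite integral_distC leeD2l//; exact: integral_dist_triangle.
Unshelve. all: by end_near. Qed.
End normed.
End bochner.

Lemma cvge0_near_lt (R : realType) (T : Type) (F : set_system T)
    {FF : Filter F} (h : T -> \bar R) (e : R) :
  h @ F --> 0%E -> 0 < e -> \forall x \near F, (h x < e%:E)%E.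
Proof.
move=> /fine_cvgP[hfin /cvgrPdist_lt h0] e0.
apply: filterS2 hfin (h0 e e0) => x hx.
by rewrite /= sub0r normrN => /ltr_normlW; rewrite -lte_fin fineK.
Qed.

Section bochner_existence.
Context d (T : measurableType d) (R : realType) (k : scalar_kind).
Context (mu : {measure set T -> \bar R}) (V : normedModType (scalars R k)).
Implicit Types g : T -> V.

(** Bochner's criterion.  Simple functions [s n] converging to [g] are
    truncated where their norm exceeds twice the norm of the limit.  The
    truncation brings them no further from [g], makes them dominated by
    [2 * G], hence gives them supports of finite measure, and dominated
    convergence applies to the distance to [g], which is at most [3 * G]. *)
Lemma bochner_integrable_of_integrable_norm g : mu_measurable mu g ->
  (\int[mu]_u (rnorm (g u))%:E < +oo)%E -> bochner_integrable mu g.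
Proof.
move=> mg goo; have [g' [s [ss sg' gg']]] := mu_measurable_ptws mg.
pose G u := rnorm (g' u).
have mG : measurable_fun setT G.
  exact: (measurable_nonexpansive_lim (@ler_dist_rnorm R k V) ss sg').
have Goo : (\int[mu]_u (G u)%:E < +oo)%E.
  apply: le_lt_trans goo; apply: ge0_ae_le_integral => [u|u|];
    rewrite ?lee_fin ?rnorm_ge0//.
  by apply: filterS gg' => u ->.
pose A n := [set u | rnorm (s n u) <= 2 * G u].
have mA n : measurable (A n).
  rewrite -[A n]setTI; apply: measurable_fun_le => //.
    exact: simple_map_measurable_fun (ss n).
  exact: measurable_funM.
pose cut (x : bool * V) : V := if x.1 then x.2 else 0.
pose t n u := cut (u \in A n, s n u).
have st n : simple (t n).
  exact: (simple_map_comp cut (simple_map_pair (simple_map_mem (mA n)) (ss n))).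
have tG n u : rnorm (t n u) <= 2 * G u.
  rewrite /t /cut /=; case: ifPn => [|_]; first by rewrite inE.
  by rewrite rnorm0 mulr_ge0// rnorm_ge0.
(* If [s n u] is cut, its norm exceeds [2 * G u], so that its distance to
   [g' u] is more than [G u], which is the distance of [0] to [g' u]. *)
have ts n u : rnorm (t n u - g' u) <= rnorm (s n u - g' u).
  rewrite /t /cut /=; case: ifPn => [//|/negP uA].
  have {uA} : 2 * G u < rnorm (s n u).
    by rewrite ltNge; apply/negP => suG; apply: uA; rewrite inE.
  rewrite sub0r rnormN -/(G u) mulrDl mul1r => GGs.
  have := ler_rnormD (s n u - g' u) (g' u).
  by rewrite subrK -/(G u) => /(lt_le_trans GGs)/ltW; rewrite lerD2r.
have tg' u : t n u @[n --> \oo] --> g' u.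
  apply/cvg_rnormP; apply: (squeeze_cvgr _ (cvg_cst 0)).
    by apply: nearW => n; apply/andP; split; [exact: rnorm_ge0|exact: ts].
  exact/cvg_rnormP.
exists t; split.
- move=> n; split => // v v0.
  (* Markov's inequality: [rnorm v] is at most [2 * G] on the fibre of [v]. *)
  have rv0 : 0 < rnorm v.
    by rewrite lt0r rnorm_ge0 andbT; apply: contraNneq v0 => /rnorm0_eq0 ->.
  have mtv : measurable (t n @^-1` [set v]) by exact: (st n).2.
  have : ((rnorm v)%:E * mu (t n @^-1` [set v]) < +oo)%E.
    apply: (@le_lt_trans _ _ (\int[mu]_u (2%:E * (G u)%:E))%E); last first.
      rewrite ge0_integralZl//; last 2 first.
      - exact/measurable_EFinP.
      - by move=> u _; rewrite lee_fin rnorm_ge0.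
      by rewrite lte_mul_pinfty.
    rewrite -[t n @^-1` _]setIT -integral_indic// -ge0_integralZl//; last 2 first.
    - exact/measurable_EFinP/measurable_indic.
    - by rewrite lee_fin ltW.
    apply: ge0_le_integral => //.
    + by move=> u _; rewrite -EFinM lee_fin mulr_ge0// rnorm_ge0.
    + by apply: emeasurable_funM => //; exact/measurable_EFinP/measurable_indic.
    + by apply: emeasurable_funM => //; exact/measurable_EFinP.
    + move=> u _; rewrite -!EFinM lee_fin indicE.
      case: (boolP (u \in _)) => [|_].
        by rewrite inE mulr1 => <-.
      by rewrite mulr0 mulr_ge0// rnorm_ge0.
  have [->|/eqP mune] := eqVneq (mu (t n @^-1` [set v])) +oo%E; last first.
    by move=> _; rewrite ltey; apply/eqP.
  by rewrite gt0_muley ?lte_fin// ltxx.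
- by apply: filterS gg' => u ->.
- apply: (@ae_dominated_cvg0 _ _ _ _ _ (fun u => 3 * G u)).
  + by move=> n u; exact: rnorm_ge0.
  + by move=> u; rewrite mulr_ge0// rnorm_ge0.
  + move=> n; apply: ae_measurable_rnorm; apply: mu_measurableB => //.
    exact: simple_mu_measurable.
  + by exists (fun u => 3 * G u); [exact: measurable_funM|exact: aeW].
  + move=> n; apply: filterS gg' => u ->.
    rewrite (le_trans (ler_rnormD _ _))// rnormN -/(G u).
    by rewrite (natrD R 1 2 : 3 = 1 + 2) mulrDl mul1r lerD2l.
  + apply: filterS gg' => u gu.
    rewrite [X in X @ _](_ : _ = fun n => rnorm (t n u - g' u)).
      exact/cvg_rnormP.
    by apply/funext => n; rewrite gu rnormB.
  + under eq_integral do rewrite EFinM.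
    rewrite ge0_integralZl//; last 2 first.
    - exact/measurable_EFinP.
    - by move=> u _; rewrite lee_fin rnorm_ge0.
    by rewrite lte_mul_pinfty.
Qed.

End bochner_existence.

Section bochner_integral.
Context d (T : measurableType d) (R : realType) (k : scalar_kind).
Context (mu : {measure set T -> \bar R}).
Context (V : completeNormedModType (scalars R k)).

(** The integrals of an approximation form a Cauchy sequence by
    [le_dist_simple_integral]. *)
Lemma cvg_simple_integral (g : T -> V) s : bochner_approximation mu g s ->
  cvg (simple_integral mu (s n) @[n --> \oo]).
Proof.
move=> as_; have [is_ _ sg] := as_.
have mg := bochner_approximation_mu_measurable as_.
have ms n := simple_mu_measurable mu (is_ n).1.
apply: cauchy_cvg; apply: cauchy_exP => e e0.
have eE := of_real_re_part (ltW e0).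
have e0' : 0 < re_part e by rewrite -(ltr_of_real k) eE of_real0.
have e2 : 0 < re_part e / 2 by rewrite divr_gt0.
have sgn : \forall n \near \oo,
    (\int[mu]_u (rnorm (g u - s n u))%:E < (re_part e / 2)%:E)%E.
  exact: cvge0_near_lt.
have [N _ sgN] := sgn.
exists (simple_integral mu (s N)); exists N => // n Nn.
rewrite /= -ball_normE /= -of_real_rnorm -eE ltr_of_real -lte_fin.
apply: le_lt_trans (le_dist_simple_integral (is_ N) (is_ n)) _.
apply: le_lt_trans (integral_dist_triangle (ms N) mg (ms n)) _.
rewrite integral_distC (splitr (re_part e)) EFinD lteD//.
  exact: (sgN N (leqnn N)).
exact: (sgN n Nn).
Qed.

Lemma bochner_integral_spec (g : T -> V) : bochner_integrable mu g ->
  exists2 s, bochner_approximation mu g s &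
    simple_integral mu (s n) @[n --> \oo] --> bochner_integral mu g.
Proof.
move=> [s as_]; rewrite /bochner_integral.
case: xgetP => [v vE [s' as' s'v]|
    /(_ (lim (simple_integral mu (s n) @[n --> \oo])))].
  by exists s'.
by case; exists s => //; exact: cvg_simple_integral as_.
Qed.
End bochner_integral.

(** * The integral of a scalar function *)

Section lebesgue_integral.
Context d (T : measurableType d) (R : realType) (k : scalar_kind).
Context (mu : {measure set T -> \bar R}).
Implicit Types (Phi : T -> scalars R k).

(** For use with the identity, for real scalars, and with the real and
    imaginary parts, for complex ones.  By linearity [phi] of the integral of
    [s n] is the real integral of [phi \o s n], whose distance to that of
    [phi \o Phi] is at most the integral of [rnorm (Phi u - s n u)]. *)
Lemma cvg_integral_functional Phi s (phi : scalars R k -> R) :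
  {morph phi : x y / x + y} ->
  (forall (x : R) (z : scalars R k), phi (of_real k x * z) = x * phi z) ->
  (forall z : scalars R k, `|phi z| <= rnorm z) ->
  lebesgue_integrable mu Phi -> bochner_approximation mu Phi s ->
  phi (simple_integral mu (s n)) @[n --> \oo] --> \int[mu]_u phi (Phi u).
Proof.
move=> phiD phiZ phile [mPhi Phioo] [is_ sPhi Phis].
have phi0 : phi 0 = 0.
  by have := phiZ 0 0; rewrite mul0r mulr0.
have phiN z : phi (- z) = - phi z.
  by apply/eqP; rewrite -addr_eq0 -phiD addNr phi0.
have phiB y z : phi (y - z) = phi y - phi z by rewrite phiD phiN.
have phioo n v : phi v != 0 -> (mu (s n @^-1` [set v]) < +oo)%E.
  by move=> v0; apply: (is_ n).2; apply: contraNneq v0 => ->; rewrite phi0.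
have sE n : phi (simple_integral mu (s n)) = \int[mu]_u phi (s n u).
  have [_ sE] := integral_simple_comp (is_ n).1 (phioo n).
  rewrite /Rintegral sE /= /simple_integral fsbig_finite; last exact: (is_ n).1.1.
  rewrite (big_morph phi phiD phi0); apply: eq_bigr => v _; exact: phiZ.
have [Phi' mPhi' PhiE] : ae_measurable mu (phi \o Phi).
  by apply: ae_measurable_nonexpansive mPhi => v w; rewrite -phiB.
have iPhi' : mu.-integrable setT (EFin \o Phi').
  apply/integrableP; split; first exact/measurable_EFinP.
  apply: le_lt_trans Phioo; apply: ge0_ae_le_integral => [u|u|].
  - by [].
  - by rewrite lee_fin rnorm_ge0.
  - by apply: filterS PhiE => u /= <-; rewrite lee_fin.
have -> : \int[mu]_u phi (Phi u) = \int[mu]_u Phi' u.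
  congr fine; apply: ae_eq_integral_nonmeasurable.
  by apply: filterS PhiE => u /= ->.
apply/cvgrPdist_lt => e e0.
apply: filterS (cvge0_near_lt Phis e0) => n; rewrite -lte_fin; apply: le_lt_trans.
have [isn _] := integral_simple_comp (is_ n).1 (phioo n).
rewrite sE -RintegralB//.
have iB : mu.-integrable setT (EFin \o (fun u => Phi' u - phi (s n u))).
  rewrite (_ : _ \o _ = (EFin \o Phi') \- (fun u => (phi (s n u))%:E))%E.
    exact: integrableB.
  by apply/funext => u.
apply: (@le_trans _ _ (\int[mu]_u `|Phi' u - phi (s n u)|)%:E).
  by rewrite lee_fin le_normr_Rintegral.
have /integrableP[_ iBoo] := iB.
rewrite /Rintegral fineK; last by rewrite ge0_fin_numE ?integral_ge0.
apply: ge0_ae_le_integral => [u|u|]; rewrite ?lee_fin ?rnorm_ge0//.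
by apply: filterS PhiE => u /= <-; rewrite -phiB lee_fin.
Qed.
End lebesgue_integral.

Lemma rnorm_complex (R : realType) (z : scalars R ComplexScalars) :
  rnorm z = Num.sqrt (complex.Re z ^+ 2 + complex.Im z ^+ 2).
Proof. by have /(congr1 (@complex.Re R)) := normc_def z. Qed.

(** Identifies the Lebesgue integral with the Bochner integral.  Over complex
    scalars, the real and imaginary parts converge separately and the modulus is
    at most the sum of their absolute values. *)
Lemma cvg_lebesgue_integral d (T : measurableType d) (R : realType)
  (k : scalar_kind) (mu : {measure set T -> \bar R}) (Phi : T -> scalars R k) s :
  lebesgue_integrable mu Phi -> bochner_approximation mu Phi s ->
  simple_integral mu (s n) @[n --> \oo] --> lebesgue_integral mu Phi.
Proof.
case: k Phi s => Phi s iPhi as_.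
  by apply: (@cvg_integral_functional _ _ _ RealScalars mu Phi s id).
have cRe : complex.Re (simple_integral mu (s n)) @[n --> \oo] -->
    \int[mu]_u complex.Re (Phi u).
  apply: (@cvg_integral_functional _ _ _ ComplexScalars mu Phi s
    (@complex.Re R)) => //.
  - by move=> [a b] [a' b'].
  - by move=> x [a b] /=; rewrite mul0r subr0.
  - move=> [a b]; rewrite rnorm_complex /= -[leLHS]sqrtr_sqr.
    by rewrite ler_wsqrtr// lerDl sqr_ge0.
have cIm : complex.Im (simple_integral mu (s n)) @[n --> \oo] -->
    \int[mu]_u complex.Im (Phi u).
  apply: (@cvg_integral_functional _ _ _ ComplexScalars mu Phi s
    (@complex.Im R)) => //.
  - by move=> [a b] [a' b'].
  - by move=> x [a b] /=; rewrite mul0r addr0.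
  - move=> [a b]; rewrite rnorm_complex /= -[leLHS]sqrtr_sqr.
    by rewrite ler_wsqrtr// lerDr sqr_ge0.
apply/cvg_rnormP.
have dist0 (h : nat -> R) l : h n @[n --> \oo] --> l ->
    `|h n - l| @[n --> \oo] --> (0 : R).
  move=> hl; rewrite (_ : 0 = `|l - l|); last by rewrite subrr normr0.
  apply: cvg_norm; apply: cvgB => //; exact: cvg_cst.
have cRI : `|complex.Re (simple_integral mu (s n))
      - \int[mu]_u complex.Re (Phi u)| +
    `|complex.Im (simple_integral mu (s n)) - \int[mu]_u complex.Im (Phi u)|
    @[n --> \oo] --> (0 : R).
  have := cvgD (dist0 _ _ cRe) (dist0 _ _ cIm); rewrite addr0; exact.
apply: squeeze_cvgr; [|exact: cvg_cst|exact: cRI].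
apply: nearW => n; rewrite rnorm_ge0 rnorm_complex /=.
case: (simple_integral mu (s n)) => a b /=.
set x := a - _; set y := b - _.
rewrite -[leRHS]ger0_norm ?addr_ge0// -[leRHS]sqrtr_sqr.
apply: ler_wsqrtr; rewrite [leRHS]sqrrD !real_normK ?num_real//.
by rewrite [leRHS]addrAC lerDl mulrn_wge0// mulr_ge0.
Qed.

Section constant_factor.
Context d (T : measurableType d) (R : realType) (k : scalar_kind).
Context (mu : {measure set T -> \bar R}) (V : normedModType (scalars R k)).

(** Pulling the constant vector [l] out of the integral: this reduces the
    Bochner integral of [Phi u *: l] to the Lebesgue integral of [Phi]. *)
Lemma bochner_approximation_scale (Phi : T -> scalars R k) s (l : V) :
  bochner_approximation mu Phi s ->
  bochner_approximation mu (fun u => Phi u *: l) (fun n u => s n u *: l) /\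
  forall n, simple_integral mu (fun u => s n u *: l) =
    simple_integral mu (s n) *: l.
Proof.
move=> as_; have mPhi := bochner_approximation_mu_measurable as_.
have [is_ sPhi Phis] := as_.
have loo n (v : scalars R k) : v *: l != 0 -> (mu (s n @^-1` [set v]) < +oo)%E.
  by move=> v0; apply: (is_ n).2; apply: contraNneq v0 => ->; rewrite scale0r.
have sE n := simple_integral_comp (is_ n).1 (loo n).
split; last first.
  move=> n; rewrite [LHS](sE n).2 /simple_integral fsbig_finite; last first.
    exact: (is_ n).1.1.
  by rewrite scaler_suml; apply: eq_bigr => x _; rewrite scalerA.
split.
- by move=> n; exact: (sE n).1.
- apply: filterS sPhi => u su; apply: cvgZ su _; exact: cvg_cst.
- under eq_fun => n do under eq_integral do
    rewrite -scalerBl rnormZ mulrC.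
  under eq_fun => n.
    rewrite ae_integralZl ?rnorm_ge0//; last 2 first.
    + by move=> u; exact: rnorm_ge0.
    + apply: ae_measurable_rnorm; apply: mu_measurableB => //.
      exact/simple_mu_measurable/(is_ n).1.
    over.
  by rewrite -(mule0 (rnorm l)%:E); apply: cvgeZl.
Qed.
End constant_factor.

(** * Regularity of Hausdorff-type operators *)

(** A filter with a countable base has a decreasing sequence of members that is
    a base; if [g] leaves a neighbourhood of [l] on each of them, choosing a bad
    point in each gives a sequence that contradicts the hypothesis.  Dominated
    convergence is a statement on sequences, whence the use of this lemma. *)
Lemma countable_base_cvg (S : Type) (F : set_system S) {FF : Filter F}
  (X : topologicalType) (g : S -> X) (l : X) :
  has_countable_base F ->
  (forall x : nat -> S, F `<=` x @ \oo -> g (x n) @[n --> \oo] --> l) ->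
  g @ F --> l.
Proof.
move=> [D /countable_injP[i i_inj] FE] seqcvg U Ul.
(* [e] enumerates the base; the indices that no member of the base has are sent
   to [setT], which is harmless since [setT] belongs to [F]. *)
pose e n := xget setT [set B | D B /\ i B = n].
have Fe n : F (e n).
  rewrite /e; case: xgetP => [B _ [DB _]|_]; last exact: filterT.
  by rewrite FE; exists B.
have eK B : D B -> e (i B) = B.
  move=> DB; rewrite /e; case: xgetP => [B' _ [DB' iB']|/(_ B)/not_andP[]//].
  by apply: i_inj; rewrite ?inE.
have FB n : F [set y | forall m, (m <= n)%N -> e m y].
  elim: n => [|n IHn].
    by apply: filterS (Fe 0) => y ey m; rewrite leqn0 => /eqP ->.
  apply: filterS2 IHn (Fe n.+1) => y IHy ey m.
  by rewrite leq_eqVlt => /predU1P[->//|]; rewrite ltnS; exact: IHy.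
apply: contrapT => FU.
have /choice[x xP] : forall n, exists x,
    (forall m, (m <= n)%N -> e m x) /\ ~ U (g x).
  move=> n; apply: contrapT => /forallNP nx; apply: FU.
  apply: (@filterS _ F FF _ _ _ (FB n)) => y ey.
  by apply: contrapT => Ugy; apply: (nx y); split.
have Fx : F `<=` x @ \oo.
  move=> B; rewrite {1}FE => -[B0 DB0 B0B].
  exists (i B0) => // n /= in_; apply: B0B.
  by have := (xP n).1 (i B0) in_; rewrite eK.
have [N _ /(_ N (leqnn N))] := seqcvg x Fx U Ul.
exact: (xP N).2.
Qed.

Theorem proposition3
  (R : realType) (k : scalar_kind)
  (C : structured_sets) (S : object C)
  (F : set_system (carrier S)) (FF : Filter F) (cbF : has_countable_base F)
  (d : measure_display) (Omega : measurableType d)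
  (mu : {measure set Omega -> \bar R})
  (Phi : Omega -> scalars R k)
  (mPhi : mu_measurable mu Phi)
  (A : Omega -> carrier S -> carrier S)
  (autA : forall u : Omega, is_automorphism (A u))
  (agrA : agrees_with_filter A F)
  (iPhi : lebesgue_integrable mu Phi)
  (Phi1 : lebesgue_integral mu Phi = 1) :
  forall (V : completeNormedModType (scalars R k)) (f : carrier S -> V),
    bounded_fun f ->
    (forall x : carrier S, mu_measurable mu (fun u => f (A u x))) ->
    (forall x : carrier S,
       bochner_integrable mu (fun u => Phi u *: f (A u x))) /\
    (forall l : V, f @ F --> l -> hausdorff_operator mu Phi A f @ F --> l).
Proof.
move=> V f bf mfA; have [M0 fM0] := @filter_ex _ (pinfty_nbhs _) _ _ bf.
pose M := re_part M0.
have fM y : rnorm (f y) <= M.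
  have fy : `|f y| <= M0 by exact: fM0.
  rewrite -(ler_of_real k) of_real_rnorm of_real_re_part//.
  exact: le_trans fy.
have mPhif x := mu_measurableZ mPhi (mfA x).
have normPhi0 (u : Omega) : 0 <= rnorm (Phi u) by exact: rnorm_ge0.
have Phioo c : 0 <= c -> (\int[mu]_u (c * rnorm (Phi u))%:E < +oo)%E.
  move=> c0; rewrite ae_integralZl//; last exact: ae_measurable_rnorm.
  by rewrite lte_mul_pinfty//; exact: iPhi.2.
have iPhif x : bochner_integrable mu (fun u => Phi u *: f (A u x)).
  apply: bochner_integrable_of_integrable_norm => //.
  apply: (@le_lt_trans _ _ (\int[mu]_u (M * rnorm (Phi u))%:E)%E); last first.
    by apply: Phioo; rewrite (le_trans _ (fM x))// rnorm_ge0.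
  apply: ge0_ae_le_integral => [u|u|].
  - by rewrite lee_fin rnorm_ge0.
  - by rewrite lee_fin mulr_ge0// (le_trans _ (fM x))// rnorm_ge0.
  - by apply: aeW => u; rewrite lee_fin rnormZ mulrC ler_wpM2r.
split => // l fl.
have [s as_] := bochner_integrable_of_integrable_norm mPhi iPhi.2.
have [asl slE] := bochner_approximation_scale l as_.
have sl : simple_integral mu (fun u => s n u *: l) @[n --> \oo] --> l.
  under eq_fun do rewrite slE.
  rewrite -[X in nbhs X](scale1r l) -Phi1.
  by apply: cvgZ; [exact: cvg_lebesgue_integral|exact: cvg_cst].
(* As [l] is the integral of [Phi u *: l], the problem is reduced to the
   convergence to [0] of an integral of nonnegative functions. *)
have Hle x : ((rnorm (hausdorff_operator mu Phi A f x - l))%:E <=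
    \int[mu]_u (rnorm (Phi u *: f (A u x) - Phi u *: l))%:E)%E.
  have [t at_ tH] := bochner_integral_spec (iPhif x).
  exact: bochner_limit_dist at_ asl tH sl.
apply: countable_base_cvg => // x Fx.
apply/cvg_rnormP/cvgrPdist_lt => e e0.
pose c := M + rnorm l.
have c0 : 0 <= c.
  by rewrite addr_ge0 ?rnorm_ge0// (le_trans _ (fM (x 0)))// rnorm_ge0.
have normB u n : rnorm (Phi u *: f (A u (x n)) - Phi u *: l) =
    rnorm (Phi u) * rnorm (f (A u (x n)) - l) by rewrite -scalerBr rnormZ.
have int0 : (\int[mu]_u (rnorm (Phi u *: f (A u (x n)) - Phi u *: l))%:E)%E
    @[n --> \oo] --> 0%E.
  apply: (@ae_dominated_cvg0 _ _ _ mu _ (fun u => c * rnorm (Phi u))).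
  - by move=> n u; exact: rnorm_ge0.
  - by move=> u; rewrite mulr_ge0.
  - move=> n; apply/ae_measurable_rnorm/mu_measurableB => //.
    exact: bochner_approximation_mu_measurable asl.
  - exact: ae_measurableZl (ae_measurable_rnorm mPhi).
  - move=> n; apply: aeW => u; rewrite normB mulrC ler_wpM2r//.
    by rewrite (le_trans (ler_rnormD _ _))// rnormN lerD2r.
  - apply: aeW => u; under eq_fun do rewrite normB.
    rewrite -(mulr0 (rnorm (Phi u))).
    apply: cvgM; first exact: cvg_cst.
    have fxl : f (A u (x n)) @[n --> \oo] --> l.
      by move=> U Ul; exact: (Fx _ (agrA u _ (fl U Ul))).
    exact/cvg_rnormP.
  - exact: Phioo.
apply: filterS (cvge0_near_lt int0 e0) => n lt_e.
rewrite sub0r normrN ger0_norm ?rnorm_ge0// -lte_fin.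
exact: le_lt_trans lt_e.
Qed.
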